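(* Let $p\in(0,1)$, $q=1-p$, let $X_n$ be the number of correct guesses under the optimal strategy in the complete feedback game after one asymmetric single-shelf shuffle of $n\ge1$ cards with parameter $p$, and let $\pi_{n,k}:=\mathbb{P}(X_n=k)$ for integers $k$. For $0<p<\frac12$ put $\nu=\left\lfloor \frac{\log p}{\log(1-p)}\right\rfloor+1$. Then: (1) If $p\ge \frac{1}{2}$, then \[ \pi_{n,k}=\sum_{m=n-k}^{k}\binom{m-1}{n-k-1}\binom{n-m}{n-k}\,q^m p^{\,n-1-m} \qquad\text{for } \lceil n/2\rceil\le k\le n-1, \] $\pi_{n,n}=p^{\,n-1}$, and $\pi_{n,k}=0$ otherwise. (2) If $0<p<\frac12$ and $1\le n\le \nu$, then \[ \pi_{n,k}=\binom{n-1}{k-1}q^{\,k-1}p^{\,n-k},\qquad 1\le k\le n, \] and $\pi_{n,k}=0$ otherwise. (3) If $0<p<\frac12$ and $n>\nu$, then \[ \pi_{n,k}=p\,\pi_{n-1,k-1}+\sum_{j=2}^{n-1}pq^{j-1}\pi_{n-j,k-j+1}+q^{n-1}\mathbf{1}_{\{k=n-1\}}, \] with the initial condition \[ \pi_{m,k}=\binom{m-1}{k-1}q^{\,k-1}p^{\,m-k},\qquad 1\le m\le \nu,\ \ 1\le k\le m. \]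
   Context: Asymmetric single-shelf shuffle with parameter $p\in(0,1)$: start with an ordered deck of $n$ cards labelled $1,\dots,n$ (card $1$ on top). Cards are drawn one at a time from the bottom of the deck (card $n$ first, card $1$ last) and placed in a pile; independently, each drawn card is placed at the top of the pile with probability $p$ and at the bottom with probability $1-p$. Equivalently, let $\varepsilon_1,\dots,\varepsilon_{n-1}$ be independent Bernoulli$(p)$ ($\varepsilon_j=1$ iff card $j$ is placed at the top); the shuffled deck read from the top consists of the cards $j\le n-1$ with $\varepsilon_j=1$ in increasing order, then card $n$, then the cards with $\varepsilon_j=0$ in decreasing order. Complete feedback game: the player guesses the cards of the shuffled deck sequentially from the top; after each guess the card is shown and removed. Optimal strategy used: let $j$ be the label of the last card shown ($j=0$ before the first guess). As long as neither card $n$ nor card $n-1$ has been shown: if $p\ge\frac12$, guess $j+1$; if $p<\frac12$, guess $n$ when $n-j\le\nu$ and guess $j+1$ when $n-j>\nu$. Once card $n$ or $n-1$ has been shown, guess the remaining cards in decreasing order. $X_n=X_n(p)$ denotes the number of correct guesses under this strategy. Conventions: $\binom{0}{0}=1$ and $\binom{a}{b}=0$ if $a<b$; $\pi_{m,k}=0$ whenever $k$ is not in $\{1,\dots,m\}$. *)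

(* Defs.v *)
From HB Require Import structures.
From mathcomp Require Import all_boot all_order all_algebra.
From mathcomp Require Import reals exp bernoulli_distribution.

Set Implicit Arguments.
Unset Strict Implicit.
Unset Printing Implicit Defensive.

Import Order.TTheory GRing.Theory Num.Theory.
Local Open Scope ring_scope.

(* Decks and piles are sequences of labels in {1, ..., n}, listed from the
   top.  The coin of card c is the component of index c - 1 of the tuple. *)

Definition coin n (e : n.-tuple bool) (c : nat) : bool := nth false e c.-1.

Definition place (top : bool) (c : nat) (pile : seq nat) : seq nat :=
  if top then c :: pile else rcons pile c.

(* [foldr] over 1, ..., n handles card n first and card 1 last, that is, it
   draws from the bottom of the ordered deck. *)
Definition shuffle n (e : n.-tuple bool) : seq nat :=
  foldr (fun c pile => place (coin e c) c pile) [::] (iota 1 n).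

Lemma shuffleE n (e : n.+1.-tuple bool) :
  shuffle e = [seq c <- iota 1 n | coin e c] ++
    n.+1 :: rev [seq c <- iota 1 n | ~~ coin e c].
Proof.
have iotaS : iota 1 n.+1 = iota 1 n ++ [:: n.+1].
  by rewrite -[in LHS](addn1 n) iotaD add1n.
rewrite /shuffle iotaS foldr_cat /=.
have -> : place (coin e n.+1) n.+1 [::] = [:: n.+1].
  by rewrite /place; case: (coin e n.+1).
elim: (iota 1 n) => //= c s ->; rewrite /place; case: (coin e c) => //=.
by rewrite rev_cons -cats1 -catA /= cats1.
Qed.

Section Game.
Variables (R : realType) (p : R).

Definition nu : int := Num.floor (ln p / ln (1 - p)) + 1.

(* The next guess when [shown] is the sequence of cards already shown, in
   order of appearance; labels start at 1, so [last 0 shown] is 0 exactly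
   before the first guess and card n - 1 does not exist when n = 1. *)
Definition guess (n : nat) (shown : seq nat) : nat :=
  let j := last 0%N shown in
  if (n \in shown) || (n.-1 \in shown) then
    (\max_(1 <= c < n.+1 | c \notin shown) c)%N
  else if 2^-1 <= p then j.+1
  else if n%:Z - j%:Z <= nu then n
  else j.+1.

Definition correct_guesses n (e : n.-tuple bool) : nat :=
  (\sum_(i < n) (guess n (take i (shuffle e)) == nth 0 (shuffle e) i))%N.

(* The law of n independent Bernoulli(p) coins. *)
Definition coins_prob n (A : pred (n.-tuple bool)) : R :=
  \sum_(e : n.-tuple bool | A e) \prod_(i < n) bernoulli_pmf p (tnth e i).

Definition pi_ (n : nat) (k : int) : R :=
  coins_prob (fun e : n.-tuple bool => (correct_guesses e)%:Z == k).

End Game.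

(* Main.v *)
Require Import Defs.
From HB Require Import structures.
From mathcomp Require Import all_boot all_order all_algebra.
From mathcomp Require Import reals exp bernoulli_distribution.
From mathcomp Require Import zify ring lra.

Import Order.TTheory GRing.Theory Num.Theory.
Local Open Scope ring_scope.

(** Up to the moment when card [n] appears, the shuffled deck is an increasing
    run of the cards whose coin is heads; afterwards it consists of the other
    cards in decreasing order, and every guess there is right.  So each card
    below [n] with a tails coin is worth exactly one point, and what remains is
    to know which guesses are right along the increasing run and at card [n]
    itself.

    This can be read off by running through the coins of cards [1, ..., n] in
    increasing order with three states: the current guess is the next label
    ([AimNext]), or card [n] ([AimLargest]), or a label that has already been
    skipped and can no longer appear now ([AimMissed]).  A heads coin shows the
    card and renews the guess, by a rule that depends only on how many labels
    lie ahead; a tails coin turns [AimNext] into [AimMissed].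
    [correct_guessesE] identifies the number of right guesses with the [score]
    of this automaton.

    Conditioning on the first coin then gives one-step recursions for the law
    of the score ([score_law_cons]), and the three parts of the theorem are
    three ways of solving them.
    - If the guess is always the next label, an error occurs exactly once per
      maximal run of tails, so one counts coin words with [m] tails in [r]
      runs.  The counts from the states [AimNext] and [AimMissed] satisfy a
      joint Pascal recursion ([score_law_next]).
    - If the guess is always card [n], it stays so until card [n] appears, and
      the score is one plus the number of tails: a binomial law
      ([score_law_largest]).
    - In general, the state [AimMissed] lasts until the next heads, where a
      game with fewer cards starts afresh; summing over the position of that
      heads ([score_law_missed]) gives the recursion of part (3). *)

(** * The game as an automaton reading the coins *)

Variant aim := AimNext | AimLargest | AimMissed.

(** The state right after a card is shown (or at the start), with [d] larger
    labels ahead; [t d] tells whether the next label is then guessed. *)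
Definition fresh_aim (t : nat -> bool) (d : nat) : aim :=
  if t d then AimNext else AimLargest.

Definition skip_aim (a : aim) : aim := if a is AimNext then AimMissed else a.

(** The points brought by the coins [e] of the labels not yet passed.  The last
    entry belongs to card [n], whose coin is irrelevant: it is only asked
    whether the pending guess is right there.  A tails coin is credited at once
    for the right guess which its card yields at the end of the game. *)
Fixpoint score (t : nat -> bool) (a : aim) (e : seq bool) : nat :=
  match e with
  | [::] => 0
  | b :: e' =>
    if nilp e' then (if a is AimMissed then 0 else 1)
    else if b then
      (if a is AimNext then 1 else 0) + score t (fresh_aim t (size e')) e'
    else (score t (skip_aim a) e').+1
  end%N.

Lemma score_cons t a b e : (0 < size e)%N ->
  score t a (b :: e) =
    if b then ((if a is AimNext then 1 else 0)
                 + score t (fresh_aim t (size e)) e)%N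
    else (score t (skip_aim a) e).+1.
Proof. by case: e. Qed.

Fixpoint hits (g : seq nat -> nat) (shown rest : seq nat) : nat :=
  if rest is c :: rest' then ((g shown == c) + hits g (rcons shown c) rest')%N
  else 0%N.

Lemma sum_hits g shown rest :
  (\sum_(i < size rest) (g (shown ++ take i rest) == nth 0 rest i))%N
    = hits g shown rest.
Proof.
elim: rest shown => [|c rest IH] shown; first by rewrite big_ord0.
rewrite big_ord_recl /= cats0 -IH; congr addn.
by apply: eq_bigr => i _ /=; rewrite cat_rcons.
Qed.

(** * The number of right guesses is the score of the coins *)

Section Guesses.
Variables (R : realType) (p : R).

Definition follows (d : nat) : bool := (2^-1 <= p) || (nu p < d%:Z).

Lemma guess_early n shown : n \notin shown -> n.-1 \notin shown ->
  (last 0%N shown <= n)%N ->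
  guess p n shown =
    if follows (n - last 0 shown)%N then (last 0%N shown).+1 else n.
Proof.
move=> h1 h2 le; rewrite /guess (negbTE h1) (negbTE h2) /= /follows.
case: (2^-1 <= p) => //=; rewrite subzn // ltNge.
by case: (_ <= _).
Qed.

Lemma guess_late n shown c : (n \in shown) || (n.-1 \in shown) ->
  (0 < c <= n)%N -> c \notin shown ->
  (forall x, (0 < x <= n)%N -> x \notin shown -> (x <= c)%N) ->
  guess p n shown = c.
Proof.
move=> h /andP[c0 cn] ci cmax; rewrite /guess h; apply/eqP; rewrite eqn_leq.
apply/andP; split.
  rewrite big_nat_cond; apply/bigmax_leqP_seq => x _ /andP[xr xs].
  exact: cmax.
by apply: (@leq_bigmax_seq _ _ _ id) => //; rewrite mem_index_iota c0 ltnS.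
Qed.

(** Behind card [n] the cards are sorted downwards, so the largest card left is
    always the one on top. *)
Lemma hits_after_largest n shown rest :
  n \in shown -> perm_eq (shown ++ rest) (iota 1 n) -> sorted gtn rest ->
  hits (guess p n) shown rest = size rest.
Proof.
elim: rest shown => //= c rest IH shown ns pe srt.
have un : uniq (shown ++ c :: rest) by rewrite (perm_uniq pe) iota_uniq.
have memE x : (x \in shown ++ c :: rest) = (0 < x <= n)%N.
  by rewrite (perm_mem pe) mem_iota add1n ltnS.
rewrite (guess_late n shown c) ?ns //.
- rewrite eqxx IH //; last exact: path_sorted srt.
    by rewrite mem_rcons inE ns orbT.
  by rewrite cat_rcons.
- by rewrite -memE mem_cat inE eqxx orbT.
- by move: un; rewrite cat_uniq /= negb_or => /and3P[_ /andP[]].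
move=> x; rewrite -memE mem_cat => /orP[-> //|].
rewrite inE => /orP[/eqP-> //|xr _].
have tr : transitive gtn by move=> a b d /= h1 h2; apply: ltn_trans h2 h1.
by apply: ltnW; have /allP/(_ _ xr) := order_path_min tr srt.
Qed.

(** What a state asserts about the current guess [x] when [c] is the smallest
    label not yet passed; only [x] compared with [c, ..., n] matters. *)
Definition aim_guesses (a : aim) (n c x : nat) : bool :=
  match a with
  | AimNext => x == c
  | AimLargest => x == n
  | AimMissed => (x < c)%N
  end.

(** Both branches of the strategy agree with the automaton.  When [c] is
    [n - 1] the late rule is already in force, but the largest card left is
    [n], which is also the next label and the target of [AimLargest]. *)
Lemma fresh_aim_guesses n shown c : (0 < c < n)%N ->
  {in shown, forall x, (x < c)%N} ->
  aim_guesses (fresh_aim follows (n - c)) n c.+1 (guess p n (rcons shown c)).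
Proof.
move=> /andP[c0 cn] lt.
have nin : n \notin rcons shown c.
  rewrite mem_rcons inE negb_or; apply/andP; split; first by lia.
  by apply/negP => /lt; lia.
have -> : guess p n (rcons shown c) = if follows (n - c) then c.+1 else n.
  have [e|ne] := eqVneq c n.-1.
    have -> : guess p n (rcons shown c) = n.
      apply: guess_late => //; try lia.
        by apply/orP; right; rewrite -e mem_rcons mem_head.
    have -> : c.+1 = n by lia.
    by case: (follows _).
  rewrite guess_early ?last_rcons //; last by lia.
  rewrite mem_rcons inE negb_or eq_sym ne /=.
  by apply/negP => /lt; lia.
by rewrite /fresh_aim; case: (follows _) => /=.
Qed.

(** Induction on the [m] labels left before card [n].  The score counts the
    tails cards among them early while [hits] counts all tails cards, listed in
    [tl], at the end; adding both numbers reconciles the two accounts. *)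
Lemma hits_score (coins : nat -> bool) n shown c m a tl :
  (0 < c)%N -> (c + m = n)%N ->
  {in shown, forall x, (x < c)%N} ->
  perm_eq (shown ++ [seq x <- iota c m | coins x] ++ n :: tl) (iota 1 n) ->
  sorted gtn tl ->
  aim_guesses a n c (guess p n shown) ->
  (hits (guess p n) shown ([seq x <- iota c m | coins x] ++ n :: tl)
     + count (predC coins) (iota c m)
   = score follows a (map coins (iota c m.+1)) + size tl)%N.
Proof.
elim: m c shown a => [|m IH] c shown a c0 cmn lt pe srt ag.
  rewrite /= addn0; rewrite addn0 in cmn; subst c.
  rewrite hits_after_largest //; last 2 first.
  - by rewrite mem_rcons inE eqxx.
  - by rewrite cat_rcons.
  congr addn; case: a ag => /=; try by move->.
  by rewrite ltn_neqAle => /andP[/negbTE->].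
have iotaS k : iota c k.+1 = c :: iota c.+1 k by [].
rewrite iotaS in pe *; rewrite (iotaS m.+1).
(* An opaque name keeps the remaining coins from being unfolded further. *)
have: iota c.+1 m.+1 = iota c.+1 m.+1 by [].
move: {1 3}(iota c.+1 m.+1) => rst rstE.
have szr : size (map coins rst) = (n - c)%N.
  by rewrite rstE size_map size_iota; lia.
rewrite map_cons score_cons ?szr; last by lia.
move: pe; case cc : (coins c); rewrite /= cc => pe.
- rewrite rstE -addnA add0n cat_cons /=.
  rewrite -(IH c.+1 (rcons shown c)) //; try lia; last first.
  + by apply: fresh_aim_guesses => //; lia.
  + by rewrite cat_rcons.
  + by move=> x; rewrite mem_rcons inE => /orP[/eqP->//|/lt]; lia.
  rewrite addnA; congr (_ + _ + _)%N.
  case: a ag => /= [/eqP->|/eqP->|]; rewrite ?eqxx //; first by lia.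
  by rewrite ltn_neqAle => /andP[/negbTE->].
- rewrite rstE addSn -(IH c.+1 shown (skip_aim a)) //; try lia.
  + by move=> x /lt; lia.
  + by case: a ag => //= [/eqP->|]; lia.
Qed.

Lemma correct_guessesE n (e : n.+1.-tuple bool) :
  correct_guesses p e = score follows (fresh_aim follows n.+1) e.
Proof.
set coins := coin e.
pose A := [seq c <- iota 1 n | coins c].
pose B := [seq c <- iota 1 n | ~~ coins c].
have DE : shuffle e = A ++ n.+1 :: rev B by exact: shuffleE.
have pe : perm_eq ([::] ++ A ++ n.+1 :: rev B) (iota 1 n.+1).
  have -> : iota 1 n.+1 = iota 1 n ++ [:: n.+1].
    by rewrite -[in LHS](addn1 n) iotaD add1n.
  apply/permP => P; rewrite cat0s !count_cat /= count_rev.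
  rewrite -(permP (permEl (perm_filterC coins (iota 1 n)))) count_cat.
  by rewrite addn0 addnCA addnC.
have szD : size (shuffle e) = n.+1.
  by rewrite DE (perm_size pe) size_iota.
have eE : tval e = map coins (iota 1 n.+1).
  apply: (@eq_from_nth _ false); first by rewrite size_map size_iota size_tuple.
  move=> i; rewrite size_tuple => lt.
  by rewrite (nth_map 0%N) ?size_iota // nth_iota // /coins /coin add1n.
have -> : correct_guesses p e = hits (guess p n.+1) [::] (shuffle e).
  by rewrite -sum_hits szD.
apply/eqP; rewrite -(eqn_add2r (size (rev B))) eE; apply/eqP.
rewrite -(hits_score coins n.+1 [::] 1 n) //.
- by rewrite DE size_rev size_filter.
- rewrite rev_sorted; apply: sorted_filter; first exact: ltn_trans.
  exact: iota_ltn_sorted.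
- case: (posnP n) => [->|n0].
    have -> : guess p 1 [::] = 1%N.
      by rewrite guess_early //=; case: (follows _).
    by rewrite /fresh_aim; case: (follows _).
  rewrite guess_early //= ?subn0.
  by rewrite /fresh_aim; case: (follows _) => /=.
Qed.

End Guesses.

(** * The law of the score *)

Section Law.
Variables (R : realType) (p : R).

Lemma eq_coins_prob n (A B : pred (n.-tuple bool)) :
  A =1 B -> coins_prob p A = coins_prob p B.
Proof. by move=> eAB; apply: eq_bigl. Qed.

Lemma coins_prob0 n (A : pred (n.-tuple bool)) :
  (forall e, ~~ A e) -> coins_prob p A = 0.
Proof. by move=> A0; apply: big_pred0 => e; apply: negbTE. Qed.

Lemma coins_prob_nil (A : pred (seq bool)) :
  coins_prob p (fun e : 0.-tuple bool => A e) = (A [::])%:R.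
Proof.
rewrite /coins_prob big_mkcond (bigD1 [tuple]) //= big_ord0 big1 ?addr0.
  by case: (A _).
by move=> e /eqP[]; exact: tuple0.
Qed.

Lemma coins_prob_cons n (A : pred (seq bool)) :
  coins_prob p (fun e : n.+1.-tuple bool => A e) =
    p * coins_prob p (fun e : n.-tuple bool => A (true :: e))
    + (1 - p) * coins_prob p (fun e : n.-tuple bool => A (false :: e)).
Proof.
pose f (x : bool * n.-tuple bool) : n.+1.-tuple bool := cons_tuple x.1 x.2.
have bij_f : bijective f.
  exists (fun e => (thead e, behead_tuple e)) => [[b e]|e].
    by rewrite /f theadE; congr (_, _); apply: val_inj.
  by rewrite [RHS]tuple_eta; apply: val_inj.
rewrite /coins_prob (reindex f); last exact: onW_bij.
rewrite big_mkcond.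
rewrite -(pair_bigA _ (fun b (e : n.-tuple bool) => if A (b :: e)
  then \prod_(i < n.+1) bernoulli_pmf p (tnth (f (b, e)) i) else 0)) /=.
rewrite big_bool /=; congr (_ + _); rewrite big_distrr [RHS]big_mkcond;
  apply: eq_bigr => e _; case: ifP => // _; rewrite big_ord_recl tnth0;
  congr (_ * _); apply: eq_bigr => i _; by rewrite tnthS.
Qed.

Definition score_law (t : nat -> bool) (a : aim) (d : nat) (k : int) : R :=
  coins_prob p (fun e : d.-tuple bool => (score t a e)%:Z == k).

Variable t : nat -> bool.

Lemma score_law1 a k :
  score_law t a 1 k = (k == if a is AimMissed then 0 else 1)%:R.
Proof.
rewrite /score_law (coins_prob_cons 0 (fun e => (score t a e)%:Z == k)).
rewrite !(coins_prob_nil (fun e => (score t a (_ :: e))%:Z == k)) /=.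
by rewrite -mulrDl addrC subrK mul1r eq_sym; case: a.
Qed.

(** Condition on the first coin.  The shorter games keep the same rule [t], as
    it depends on the number of coins ahead and not on the deck size. *)
Lemma score_law_cons a d k :
  score_law t a d.+2 k =
    p * score_law t (fresh_aim t d.+1) d.+1
          (k - (if a is AimNext then 1 else 0))
    + (1 - p) * score_law t (skip_aim a) d.+1 (k - 1).
Proof.
rewrite /score_law (coins_prob_cons d.+1 (fun e => (score t a e)%:Z == k)).
congr (_ * _ + _ * _); apply: eq_coins_prob => e;
  rewrite score_cons ?size_tuple //.
  by apply/eqP/eqP; case: a => /=; lia.
by apply/eqP/eqP => /=; lia.
Qed.

Lemma score_law_lt0 a d k : k < 0 -> score_law t a d k = 0.
Proof. by move=> k0; apply: coins_prob0 => e; apply/eqP; lia. Qed.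

(** Each card yields at most one point, and a missed guess costs a point at the
    next card shown. *)
Lemma score_bound a e : (0 < size e)%N ->
  (score t a e + (if a is AimMissed then 1 else 0) <= size e)%N.
Proof.
elim: e a => // b [|c e] IH a _; first by case: a.
rewrite score_cons //; case: b.
  by have := IH (fresh_aim t (size (c :: e))) isT; case: a => /=; lia.
by have := IH (skip_aim a) isT; case: a => /=; lia.
Qed.

Lemma score_law_gt a d (k : int) :
  d.+1%:Z < k + (if a is AimMissed then 1 else 0) ->
  score_law t a d.+1 k = 0.
Proof.
move=> dk; apply: coins_prob0 => e; apply/eqP => ek.
have := score_bound a e; rewrite size_tuple => /(_ isT).
by move: dk; rewrite -ek; case: a {ek}; lia.
Qed.

(** Sum over the position [j] of the first heads: the [j - 1] tails before it
    score, the heads does not, and a fresh game with [d + 1 - j] cards remains.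
    The last term is the word without heads, in which card [n] is missed. *)
Lemma score_law_missed d k :
  score_law t AimMissed d.+1 k =
    \sum_(1 <= j < d.+1) p * (1 - p) ^+ j.-1 *
       score_law t (fresh_aim t (d.+1 - j)) (d.+1 - j) (k - j%:Z + 1)
    + (1 - p) ^+ d * (k == d%:Z)%:R.
Proof.
elim: d k => [|d IH] k.
  by rewrite score_law1 big_geq // add0r expr0 mul1r.
rewrite score_law_cons IH [in RHS]big_nat_recl //.
rewrite expr0 mulr1 subSS subn0 subr0 subrK.
rewrite mulrDr -addrA /=; congr (_ + (_ + _)).
  rewrite big_distrr /=; apply: eq_big_nat => j /andP[j1 _].
  case: j j1 => // j _.
  rewrite subSS exprS /= subSS.
  have -> : k - 1 - j.+1%:Z + 1 = k - j.+2%:Z + 1 by lia.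
  ring.
rewrite exprS -mulrA; congr (_ * (_ * _%:R)); by apply/eqP/eqP; lia.
Qed.

(** If the guess is always card [n], the [k] tails among [d] coins score, and so
    does card [n] itself. *)
Lemma score_law_largest d :
  (forall i, (i <= d)%N -> t i = false) ->
  (forall k : nat, score_law t AimLargest d.+1 k.+1%:Z =
      'C(d, k)%:R * (1 - p) ^+ k * p ^+ (d - k)) /\
  (forall k, k < 1 -> score_law t AimLargest d.+1 k = 0).
Proof.
elim: d => [|d IH] tF.
  split=> k; rewrite score_law1; last by move=> k1; case: eqP => //; lia.
  by case: k => [|k]; rewrite ?mul1r ?expr0 // bin0n /= !mul0r.
have [IH1 IH2] := IH (fun i h => tF i (leqW h)).
split=> k; rewrite score_law_cons /fresh_aim tF // ?subr0; last first.
  by move=> k1; rewrite !IH2 ?mulr0 ?addr0 //; lia.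
rewrite IH1; case: k => [|k].
  by rewrite IH2 // !bin0 mulr0 addr0 !subn0 exprS expr0; ring.
have -> : k.+2%:Z - 1 = k.+1%:Z by lia.
rewrite IH1 binS natrD subSS exprS.
have [kd|kd] := ltnP k d.
  have -> : (d - k = (d - k.+1).+1)%N by lia.
  by rewrite exprS; ring.
by rewrite (bin_small (_ : (d < k.+1)%N)) //; ring.
Qed.

(** Conditioning on the first coin, for a law that weighs a word of [L] coins
    with [m] tails by [x ^+ m * y ^+ (L - m)]: [c0] counts the words that follow
    a heads, [c1] those that follow a tails. *)
Lemma binomial_mix (x y : R) (c0 c1 : nat -> R) L : c0 L.+1 = 0 ->
  \sum_(m < L.+2) (c0 m + (if (m : nat) is m'.+1 then c1 m' else 0))
    * x ^+ m * y ^+ (L.+1 - m)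
  = y * (\sum_(m < L.+1) c0 m * x ^+ m * y ^+ (L - m))
    + x * (\sum_(m < L.+1) c1 m * x ^+ m * y ^+ (L - m)).
Proof.
move=> c00; under eq_bigr do rewrite !mulrDl.
rewrite big_split /= big_ord_recr /= c00 !mul0r addr0.
rewrite [X in _ + X]big_ord_recl /= !mul0r add0r !big_distrr /=.
congr (_ + _); apply: eq_bigr => -[m mL] _ /=.
  by rewrite subSn // exprS; ring.
by rewrite /bump /= add1n subSS exprS; ring.
Qed.

(** Compositions of [m] into [r] positive parts. *)
Definition compositions (m r : nat) : nat :=
  match m, r with
  | 0, 0 => 1
  | m'.+1, r'.+1 => 'C(m', r')
  | _, _ => 0
  end.

(** Here [r] is the number of maximal runs of tails that begin in the word of
    [d] coins, each costing one point, and [m] is the number of tails.  From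
    [AimNext], the [m] tails form [r] nonempty runs placed in [r] of the
    [d - m + 1] gaps between heads.  From [AimMissed] a run is pending: one
    more point is lost, the gap in front of the first heads is reserved for the
    continuation of that run, possibly empty, so that [m] splits in
    ['C(m, r)] ways and [d - m] gaps remain.  The two formulas call each other
    through the first coin, hence the joint induction. *)
Lemma score_law_next d : (forall i, t i) -> forall r : nat,
  score_law t AimNext d.+1 (d.+1%:Z - r%:Z) =
    \sum_(m < d.+1) (compositions m r * 'C(d.+1 - m, r))%:R
      * (1 - p) ^+ m * p ^+ (d - m)
  /\ score_law t AimMissed d.+1 (d%:Z - r%:Z) =
    \sum_(m < d.+1) ('C(m, r) * 'C(d - m, r))%:R
      * (1 - p) ^+ m * p ^+ (d - m).
Proof.
move=> tT; elim: d => [|d IH] r.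
  rewrite !score_law1 !big_ord1; case: r => [|r]; split;
    rewrite /= ?mulr1 //; case: eqP => //; lia.
have fT i : fresh_aim t i = AimNext by rewrite /fresh_aim tT.
rewrite !score_law_cons !fT /=; split.
- have -> : d.+2%:Z - r%:Z - 1 = d.+1%:Z - r%:Z by lia.
  rewrite (proj1 (IH r)).
  (* A first tails opens one of the [r] runs; if [r] is 0 there is none. *)
  pose c1 m := if r is r'.+1 then ('C(m, r') * 'C(d - m, r'))%:R else 0 : R.
  have -> : score_law t AimMissed d.+1 (d.+1%:Z - r%:Z) =
      \sum_(m < d.+1) c1 m * (1 - p) ^+ m * p ^+ (d - m).
    rewrite /c1 {c1}; case: r => [|r]; last first.
      by rewrite -(proj2 (IH r)); congr score_law; lia.
    by rewrite score_law_gt ?big1 // => [m _|]; [rewrite !mul0r | lia].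
  rewrite -(binomial_mix _ _ (fun m =>
    (compositions m r * 'C(d.+1 - m, r))%:R)).
    apply: eq_bigr => -[m /= lt] _; congr (_ * _ * _).
    rewrite /c1 {c1}; case: m r lt => [|m] [|r] //= lt; rewrite ?addr0 ?bin0 //.
    by rewrite -natrD !subSS subSn // binS mulnDr.
  by clear c1; case: r => [|r] //=; rewrite subnn muln0.
- rewrite subr0 (proj1 (IH r)).
  have -> : d.+1%:Z - r%:Z - 1 = d%:Z - r%:Z by lia.
  rewrite (proj2 (IH r)).
  rewrite -(binomial_mix _ _ (fun m => (compositions m r * 'C(d.+1 - m, r))%:R)
     (fun m => ('C(m, r) * 'C(d - m, r))%:R)).
    apply: eq_bigr => -[m /= lt] _; congr (_ * _ * _).
    case: m r lt => [|m] [|r] //= lt; rewrite ?addr0 ?bin0 //.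
    - by rewrite add0r.
    by rewrite -natrD !subSS binS mulnDl addnC.
  by case: r => [|r] //=; rewrite subnn muln0.
Qed.

End Law.

(** * The three regimes *)

Lemma pi_score_law (R : realType) (p : R) n k : (0 < n)%N ->
  pi_ p n k = score_law R p (follows R p) (fresh_aim (follows R p) n) n k.
Proof.
case: n => // n _; apply: eq_coins_prob => e.
by rewrite correct_guessesE.
Qed.

(** The [r] runs need [r] tails, and the [n - m] gaps must accommodate them. *)
Lemma run_count_eq0 n r m : (0 < r)%N ->
  ~~ (r <= m <= n - r)%N -> (compositions m r * 'C(n - m, r))%N = 0%N.
Proof.
case: r => // r _; case: m => [|m] //=; rewrite negb_and -!ltnNge.
case/orP => h; first by rewrite bin_small.
by rewrite (bin_small (_ : (n - m.+1 < r.+1)%N)) ?muln0 //; lia.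
Qed.

(** Guarantees that a deck larger than the threshold has at least two cards, so
    that a first coin can be split off. *)
Lemma nu_ge1 (R : realType) (p : R) : 0 < p -> p < 1 -> 1 <= nu p.
Proof.
move=> p0 p1; rewrite /nu lerDr floor_ge0.
by apply: mulr_le0; rewrite ?invr_le0; apply: ln_le0; lra.
Qed.

Section MainCases.
Variables (R : realType) (p : R).

(** Parametrized by the number [r] of errors, one per run of tails. *)
Lemma pi_high n (r : nat) : 2^-1 <= p -> (0 < n)%N ->
  pi_ p n (n%:Z - r%:Z) = \sum_(m < n)
    (compositions m r * 'C(n - m, r))%:R * (1 - p) ^+ m * p ^+ (n - 1 - m).
Proof.
move=> hp; case: n => // n _; rewrite pi_score_law // /fresh_aim.
have fT i : follows R p i by rewrite /follows hp.
rewrite fT (proj1 (score_law_next _ _ _ n fT r)).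
by rewrite subn1.
Qed.

Lemma pi_low n : p < 2^-1 -> (0 < n)%N -> n%:Z <= nu p ->
  (forall k : nat, (1 <= k <= n)%N ->
     pi_ p n k%:Z = 'C(n.-1, k.-1)%:R * (1 - p) ^+ k.-1 * p ^+ (n - k))
  /\ (forall k : int, ~~ (1 <= k <= n%:Z) -> pi_ p n k = 0).
Proof.
move=> hp; case: n => // n _ hn.
have fF i : (i <= n.+1)%N -> follows R p i = false.
  by move=> hi; rewrite /follows leNgt hp /=; apply/negbTE; rewrite -leNgt; lia.
have [L1 L2] := score_law_largest _ p _ n (fun i h => fF i (leqW h)).
split=> k hk; rewrite pi_score_law // /fresh_aim fF //.
  by case: k hk => // k _; rewrite L1 subSS.
have [k1|k1] := ltP k 1; first exact: L2.
by apply: score_law_gt => //; lia.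
Qed.

(** The first guess is card 1.  The first coin either starts a smaller game or
    leads to [AimMissed], and [score_law_missed] supplies the sum. *)
Lemma pi_rec n k : 0 < p -> p < 1 -> nu p < n%:Z ->
  pi_ p n k = p * pi_ p n.-1 (k - 1)
    + \sum_(2 <= j < n) p * (1 - p) ^+ j.-1 * pi_ p (n - j) (k - j%:Z + 1)
    + (1 - p) ^+ n.-1 * (k == n%:Z - 1)%:R.
Proof.
move=> p0 p1 hn; have nu1 := nu_ge1 R p p0 p1.
case: n hn => [|[|n]] hn; [lia|lia|].
rewrite !pi_score_law // {1}/fresh_aim.
have -> : follows R p n.+2 by rewrite /follows hn orbT.
rewrite score_law_cons score_law_missed mulrDr addrA.
congr (_ + _ + _); first last.
  rewrite mulrA -exprS; congr (_ * _%:R); by apply/eqP/eqP; lia.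
rewrite big_distrr [RHS]big_add1 /=; apply: eq_big_nat => j /andP[j1 jn].
rewrite pi_score_law ?subSS; last by lia.
have -> : k - 1 - j%:Z + 1 = k - j.+1%:Z + 1 by lia.
by case: j j1 jn => // j _ _; rewrite exprS /=; ring.
Qed.

End MainCases.

Theorem theorem2 (R : realType) (p : R) (n : nat)
    (hp0 : 0 < p) (hp1 : p < 1) (hn : (1 <= n)%N) :
  let q := 1 - p in
  [/\ (* (1) *)
      2^-1 <= p ->
      [/\ forall k : nat, (uphalf n <= k <= n.-1)%N ->
            pi_ p n k%:Z =
              \sum_(n - k <= m < k.+1)
                'C(m.-1, (n - k).-1)%:R * 'C(n - m, n - k)%:R
                  * q ^+ m * p ^+ (n - 1 - m),
          pi_ p n n%:Z = p ^+ n.-1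
        & forall k : int, ~~ ((uphalf n)%:Z <= k <= n%:Z) -> pi_ p n k = 0],
      (* (2) *)
      p < 2^-1 -> n%:Z <= nu p ->
      (forall k : nat, (1 <= k <= n)%N ->
         pi_ p n k%:Z = 'C(n.-1, k.-1)%:R * q ^+ k.-1 * p ^+ (n - k))
      /\ (forall k : int, ~~ (1 <= k <= n%:Z) -> pi_ p n k = 0)
    & (* (3) *)
      p < 2^-1 -> nu p < n%:Z ->
      (forall k : int,
         pi_ p n k = p * pi_ p n.-1 (k - 1)
           + \sum_(2 <= j < n) p * q ^+ j.-1 * pi_ p (n - j) (k - j%:Z + 1)
           + q ^+ n.-1 * (k == n%:Z - 1)%:R)
      /\ (forall m k : nat, (1 <= m)%N -> m%:Z <= nu p -> (1 <= k <= m)%N ->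
            pi_ p m k%:Z = 'C(m.-1, k.-1)%:R * q ^+ k.-1 * p ^+ (m - k))].
Proof.
move=> q; split=> [hp|hp hnu|hp hnu].
- have piE := pi_high R p n _ hp hn.
  split=> [k hk||k hk].
  + have {1}-> : k%:Z = n%:Z - (n - k)%N%:Z by lia.
    rewrite piE -(big_mkord xpredT (fun m =>
      (compositions m (n - k) * 'C(n - m, n - k))%:R * (1 - p) ^+ m
        * p ^+ (n - 1 - m))).
    (* The terms outside the range from [n - k] to [k] vanish. *)
    rewrite (@big_cat_nat _ _ _ (n - k)) //=; last by lia.
    rewrite big_nat_cond big1 ?add0r; last first.
      by move=> m hm; rewrite run_count_eq0 ?mul0r //; lia.
    rewrite (@big_cat_nat _ _ _ k.+1) //=; try lia.
    rewrite [X in _ + X]big_nat_cond [X in _ + X]big1 ?addr0; last first.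
      by move=> m hm; rewrite run_count_eq0 ?mul0r //; lia.
    apply: eq_big_nat => m hm; rewrite -natrM.
    have r0 : (0 < n - k)%N by lia.
    by case: (n - k)%N r0 hm => [|r] //; case: m.
  + (* Without errors there is no tails: only the term [m = 0] survives. *)
    have -> : n%:Z = n%:Z - 0%N%:Z by lia.
    rewrite piE; case: n hn {piE} => // n' _.
    rewrite big_ord_recl big1 ?addr0 => [|i _]; last by rewrite mul0n !mul0r.
    by rewrite /= bin0 expr0 !mul1r subn0 subn1.
  + have [nk|kn] := ltP n%:Z k.
      case: n hn nk {hk piE} => // n' _ nk.
      rewrite pi_score_law //; apply: score_law_gt.
      by case: (fresh_aim _ _); lia.
    have [k0|k0] := ltP k 0; first by rewrite pi_score_law // score_law_lt0.
    have -> : k = n%:Z - (n - `|k|)%N%:Z by lia.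
    rewrite piE big1 // => m _; rewrite run_count_eq0 ?mul0r //.
    * by lia.
    * by move: (ltn_ord m); lia.
- exact: pi_low.
- split=> [k|m k hm hmnu hk]; first exact: pi_rec.
  exact: (proj1 (pi_low R p m hp hm hmnu)).
Qed.
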